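(* Let $X$ be a non-empty set and let $\mathcal{F}$ be a $C^{\ast}$-subalgebra of $\ell^{\infty}(X)$ containing the constant functions. If $\varphi$ is an $\mathcal{F}$-filter on $X$, then $\widehat{\varphi}=\overline{\varphi}$, where $\widehat{\varphi}=\{p\in\delta X:\varphi\subseteq p\}$ and $\overline{\varphi}=\bigcap_{A\in\varphi}\overline{e(A)}$, the closures $\overline{e(A)}$ being taken in $\delta X$.
   Context: $\ell^{\infty}(X)$ is the $C^{\ast}$-algebra of all bounded complex-valued functions on $X$ (pointwise operations, supremum norm, involution given by complex conjugation). A filter on $X$ is a non-empty family of subsets of $X$ closed under finite intersections and under supersets and not containing $\emptyset$. An $\mathcal{F}$-family on $X$ is a non-empty set $\mathcal{A}$ of non-empty subsets of $X$ such that for every $A\in\mathcal{A}$ with $A\neq X$ there exist $B\in\mathcal{A}$ and $f\in\mathcal{F}$ with $f(B)=\{0\}$ and $f(X\setminus A)=\{1\}$. An $\mathcal{F}$-filter is a filter on $X$ which is also an $\mathcal{F}$-family; an $\mathcal{F}$-ultrafilter is an $\mathcal{F}$-filter not properly contained in any other $\mathcal{F}$-filter on $X$. $\delta X$ is the set of all $\mathcal{F}$-ultrafilters on $X$; for $A\subseteq X$ put $\widehat{A}=\{p\in\delta X: A\in p\}$, and give $\delta X$ the topology having $\{\widehat{A}:A\subseteq X\}$ as a base. $\tau(\mathcal{F})$ is the weakest topology on $X$ making every $f\in\mathcal{F}$ continuous, and $\mathcal{N}_{\mathcal{F}}(x)$ is the neighborhood filter of $x$ in $(X,\tau(\mathcal{F}))$;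 it is an $\mathcal{F}$-ultrafilter. The evaluation mapping $e:X\to\delta X$ is $e(x)=\mathcal{N}_{\mathcal{F}}(x)$. *)

(* Defs.v *)
From HB Require Import structures.
From mathcomp Require Import all_boot all_order all_algebra.
From mathcomp Require Import complex ring lra.
From mathcomp Require Import all_classical all_reals all_analysis.

Set Implicit Arguments.
Unset Strict Implicit.
Unset Printing Implicit Defensive.

Import Order.TTheory GRing.Theory Num.Theory numFieldNormedType.Exports.
Import ComplexField.

Local Open Scope classical_set_scope.
Local Open Scope ring_scope.
Local Open Scope complex_scope.

(* [Normc.normc z : R] is the modulus of [z : R[i]] as an element of [R]
   (whereas [`|z|] lives in [R[i]]). *)
Definition linf (R : realType) (X : Type) : set (X -> R[i]) :=
  [set f | exists M : R, forall x, Normc.normc (f x) <= M].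

(* The supremum norm; meaningful on [linf] ([sup] is [0] on unbounded sets). *)
Definition supnorm (R : realType) (X : Type) (f : X -> R[i]) : R :=
  sup (range (fun x => Normc.normc (f x))).

Record unital_cstar_subalgebra (R : realType) (X : Type)
    (F : set (X -> R[i])) : Prop := UnitalCstarSubalgebra {
  ucs_linf : F `<=` @linf R X;
  ucs_cst : forall c : R[i], F (fun=> c);
  ucs_add : forall f g, F f -> F g -> F (fun x => f x + g x);
  ucs_scale : forall (c : R[i]) f, F f -> F (fun x => c * f x);
  ucs_mul : forall f g, F f -> F g -> F (fun x => f x * g x);
  ucs_conj : forall f, F f -> F (fun x => (f x)^*);
  ucs_closed : forall f, @linf R X f ->
    (forall e : R, 0 < e ->
       exists2 g, F g & supnorm (fun x => f x - g x) < e) ->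
    F f
}.

Section FFilters.
Variables (R : realType) (X : Type) (F : set (X -> R[i])).

Definition F_family (A : set_system X) : Prop :=
  [/\ A !=set0,
      (forall U, A U -> U !=set0) &
      forall U, A U -> U <> setT ->
        exists B f, [/\ A B, F f, f @` B = [set 0] & f @` (~` U) = [set 1]]].

Definition F_filter (p : set_system X) : Prop :=
  ProperFilter p /\ F_family p.

Definition F_ultrafilter (p : set_system X) : Prop :=
  F_filter p /\ forall q, F_filter q -> ~ (p `<` q).

Definition delta : Type := {p : set_system X | F_ultrafilter p}.

Definition hat (A : set X) : set delta := [set p | sval p A].

Definition hat_filter (phi : set_system X) : set delta :=
  [set p | phi `<=` sval p].

Let hat_cover : \bigcup_(A in [set: set X]) hat A = setT.
Proof.
apply/seteqP; split => // -[p [[pF ?] ?]] _; exists setT => //.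
exact: filterT.
Qed.

Let hat_join (A B : set X) (t : delta) : [set: set X] A -> [set: set X] B ->
  hat A t -> hat B t ->
  exists D, [/\ [set: set X] D, hat D t & hat D `<=` hat A `&` hat B].
Proof.
move=> _ _; case: t => p [[pF ?] ?] pA pB; exists (A `&` B); split => //.
  exact: filterI.
by move=> [q [[qF ?] ?]] qAB; split; apply: filterS qAB => x [].
Qed.

HB.instance Definition _ := gen_eqMixin delta.
HB.instance Definition _ := gen_choiceMixin delta.
HB.instance Definition _ :=
  isBaseTopological.Build delta hat_cover hat_join.

End FFilters.

Section Tau.
Variables (R : realType) (X : pointedType) (F : set (X -> R[i])).

(* The topology of the codomain is the usual one of [R[i]]; the norm topology is
   attached to the regular module [R[i]^o]. *)
Definition tau : topologicalType :=
  sup_topology (fun f : {f : X -> R[i] | F f} =>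
    Topological.class (initial_topology (sval f : X -> R[i]^o))).

Definition nbhsF (x : X) : set_system X := nbhs (x : tau).

End Tau.

Section Sqrt.
Variable R : realType.
Implicit Types t : R.

(* Polynomials in [t] without constant term, converging uniformly to the square
   root on [0, 1]. *)
Fixpoint sqrt_approx (n : nat) t : R :=
  if n is m.+1 then sqrt_approx m t + 2^-1 * (t - sqrt_approx m t ^+ 2)
  else 0.

Lemma sqrt_approxP n t : 0 <= t <= 1 ->
  0 <= sqrt_approx n t <= Num.sqrt t /\
  (Num.sqrt t - sqrt_approx n t) * (1 + n%:R * (Num.sqrt t / 2)) <= Num.sqrt t.
Proof.
move=> /andP[t0 t1].
have s0 : 0 <= Num.sqrt t by exact: sqrtr_ge0.
have s1 : Num.sqrt t <= 1 by rewrite -sqrtr1 ler_wsqrtr.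
have st : Num.sqrt t ^+ 2 = t by rewrite sqr_sqrtr.
elim: n => [|n [/andP[p0 ps] IH]]; first by rewrite /= mul0r; lra.
rewrite /=; set p := sqrt_approx n t in p0 ps IH *.
set s := Num.sqrt t in s0 s1 st ps IH *.
rewrite -st -[n.+1%:R]natr1.
have n0 : 0 <= n%:R :> R by exact: ler0n.
have u2 : 0 <= (s - p) * (s - p) by exact: sqr_ge0.
have E : s - (p + 2^-1 * (s ^+ 2 - p ^+ 2)) = (s - p) * (1 - (s + p) / 2).
  by field.
have d0 : 0 <= s - (p + 2^-1 * (s ^+ 2 - p ^+ 2)).
  by rewrite E mulr_ge0//; lra.
split.
  apply/andP; split; last by rewrite -subr_ge0.
  have dp : 0 <= s - p by lra.
  rewrite addr_ge0// mulr_ge0 ?invr_ge0// subr_sqr mulr_ge0//.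
  by rewrite addr_ge0.
apply: le_trans IH; rewrite E.
have dp : 0 <= s - p by lra.
rewrite -mulrA ler_wpM2l //.
have k : (1 - (s + p) / 2) * (1 + (n%:R + 1) * (s / 2)) <=
  (1 - s / 2) * (1 + (n%:R + 1) * (s / 2)).
  apply: ler_wpM2r; last by lra.
  by rewrite addr_ge0// !mulr_ge0 ?addr_ge0// invr_ge0.
apply: le_trans k _.
have : 0 <= (n%:R + 1) * (s / 2) ^+ 2 by rewrite mulr_ge0 ?addr_ge0 ?sqr_ge0.
by nra.
Qed.

Lemma sqrt_approx_le n t : 0 <= t <= 1 ->
  Num.sqrt t - sqrt_approx n.+1 t <= 2 / n.+1%:R.
Proof.
move=> t01; have [/andP[p0 ps] h] := sqrt_approxP n.+1 t01.
set s := Num.sqrt t in ps h *; set p := sqrt_approx _ t in p0 ps h *.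
have n0 : 0 < n.+1%:R :> R by rewrite ltr0n.
rewrite ler_pdivlMr//.
have dp : 0 <= s - p by lra.
have := @sqrtr_ge0 R t; rewrite -/s le_eqVlt => /orP[/eqP s0|s0].
  have -> : s - p = 0 by lra.
  by rewrite mul0r.
rewrite -(ler_pM2r s0); nra.
Qed.

End Sqrt.

Section Calculus.
Variables (R : realType) (X : Type) (F : set (X -> R[i])).
Hypothesis hF : unital_cstar_subalgebra F.
Implicit Types (g h : X -> R) (f : X -> R[i]).

Definition real_mem g : Prop := F (fun x => (g x)%:C).
Local Notation FR := real_mem.

Lemma normc_real (a : R) : Normc.normc a%:C = `|a|.
Proof. by rewrite /Normc.normc /= expr0n addr0 sqrtr_sqr. Qed.

Lemma normc_abs (z : R[i]) : (Normc.normc z)%:C = `|z|.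
Proof. by case: z. Qed.

Lemma FR_cst (a : R) : FR (fun=> a).
Proof. exact: (ucs_cst hF). Qed.

Lemma FR_add g h : FR g -> FR h -> FR (fun x => g x + h x).
Proof.
move=> Fg Fh; rewrite /FR.
under eq_fun do rewrite rmorphD /=.
exact: (ucs_add hF).
Qed.

Lemma FR_mul g h : FR g -> FR h -> FR (fun x => g x * h x).
Proof.
move=> Fg Fh; rewrite /FR.
under eq_fun do rewrite rmorphM /=.
exact: (ucs_mul hF).
Qed.

Lemma FR_scale (a : R) g : FR g -> FR (fun x => a * g x).
Proof. by move=> Fg; apply: FR_mul => //; exact: FR_cst. Qed.

Lemma FR_sub g h : FR g -> FR h -> FR (fun x => g x - h x).
Proof.
move=> Fg Fh; apply: FR_add => //.
under eq_fun do rewrite -mulN1r.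
exact: FR_scale.
Qed.

Lemma FR_bounded g : FR g -> exists2 M, 0 < M & forall x, `|g x| <= M.
Proof.
move=> /(ucs_linf hF)[M hM]; exists (`|M| + 1); first by rewrite ltr_pwDr.
by move=> x; rewrite -normc_real (le_trans (hM x))// ler_wpDr ?ler_norm.
Qed.

Lemma FR_closed g : (forall e : R, 0 < e ->
  exists2 h, FR h & forall x, `|g x - h x| <= e) -> FR g.
Proof.
move=> hg; apply: (ucs_closed hF) => [|e e0].
  have [h /FR_bounded[M M0 hM] gh] := hg 1 ltr01.
  exists (1 + M) => x; rewrite normc_real -(subrK (h x) (g x)).
  by rewrite (le_trans (ler_normD _ _))// lerD.
have [h Fh gh] := hg (e / 2) (divr_gt0 e0 (ltr0Sn R 1)).
exists (fun x => (h x)%:C) => //.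
rewrite (@le_lt_trans _ _ (e / 2))//; last by lra.
rewrite /supnorm.
have [->|ne] := eqVneq (range (fun x => Normc.normc ((g x)%:C - (h x)%:C))) set0.
  by rewrite sup0; lra.
apply: ge_sup; first exact/set0P.
by move=> _ [x _ <-]; have := gh x; rewrite -normc_real rmorphB.
Qed.

Lemma FR_sqrt g : FR g -> (forall x, 0 <= g x <= 1) ->
  FR (fun x => Num.sqrt (g x)).
Proof.
move=> Fg g01; apply: FR_closed => e e0.
have Fp n : FR (fun x => sqrt_approx n (g x)).
  elim: n => [|n IH] /=; first exact: FR_cst.
  apply: FR_add => //; apply: FR_scale; apply: FR_sub => //.
  by under eq_fun do rewrite expr2; exact: FR_mul.
have [n hn] : exists n : nat, 2 / e <= n.+1%:R.
  exists (Num.truncn (2 / e)); by rewrite ltW// truncnS_gt.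
exists (fun x => sqrt_approx n.+1 (g x)) => // x.
have [/andP[_ le] _] := sqrt_approxP n.+1 (g01 x).
rewrite ger0_norm ?subr_ge0// (le_trans (sqrt_approx_le n (g01 x)))//.
by rewrite ler_pdivrMr ?ltr0n// mulrC -ler_pdivrMr.
Qed.

Lemma FR_norm g : FR g -> FR (fun x => `|g x|).
Proof.
move=> Fg; have [M M0 hM] := FR_bounded Fg.
have -> : (fun x => `|g x|) = fun x => M * Num.sqrt (M^-1 * g x * (M^-1 * g x)).
  apply/funext => x; rewrite -expr2 sqrtr_sqr normrM gtr0_norm ?invr_gt0//.
  by rewrite mulrA divff ?mul1r// gt_eqF.
apply/FR_scale/FR_sqrt => [|x]; first by apply: FR_mul; exact: FR_scale.
rewrite -expr2 sqr_ge0 /= -real_normK ?num_real// expr_le1//.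
by rewrite normrM gtr0_norm ?invr_gt0// mulrC ler_pdivrMr// mul1r.
Qed.

(* Urysohn-type functions in the algebra, by functional calculus. *)
Lemma FR_bump g (a b : R) : FR g -> a < b ->
  exists k : X -> R[i], [/\ F k, forall x, g x <= a -> k x = 0 &
    forall x, b <= g x -> k x = 1].
Proof.
move=> Fg ab; pose u x := (b - a)^-1 * (g x - a).
pose v x := 2^-1 * (`|u x| - `|u x - 1| + 1).
have ba : 0 < b - a by rewrite subr_gt0.
have Fu : FR u by apply/FR_scale/FR_sub => //; exact: FR_cst.
exists (fun x => (v x)%:C); split => [|x xa|x xb].
- apply/FR_scale/FR_add; last exact: FR_cst.
  by apply: FR_sub; apply: FR_norm => //; apply: FR_sub => //; exact: FR_cst.
- have u0 : u x <= 0 by rewrite /u mulr_ge0_le0 ?invr_ge0 ?subr_le0// ltW.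
  rewrite /v ler0_norm// ler0_norm; last lra.
  by rewrite [X in X%:C](_ : _ = 0)//; lra.
- have u1 : 1 <= u x by rewrite /u mulrC ler_pdivlMr// mul1r lerD2r.
  rewrite /v ger0_norm; last lra.
  rewrite ger0_norm; last lra.
  by rewrite [X in X%:C](_ : _ = 1)//; lra.
Qed.

Lemma FR_sqr_dist f (c : R[i]) : F f -> FR (fun x => Normc.normc (f x - c) ^+ 2).
Proof.
move=> Ff; rewrite /FR.
have Ffc : F (fun x => f x - c).
  by apply: (ucs_add hF) => //; exact: (ucs_cst hF).
under eq_fun do rewrite rmorphXn /= normc_abs sqr_normc.
by apply: (ucs_mul hF) => //; exact: (ucs_conj hF).
Qed.

End Calculus.

Section NbhsF.
Variables (R : realType) (X : pointedType) (F : set (X -> R[i])).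
Hypothesis hF : unital_cstar_subalgebra F.

Lemma nbhsF_dist f (x : X) (e : R) : F f -> 0 < e ->
  nbhsF F x [set y | Normc.normc (f y - f x) < e].
Proof.
move=> Ff e0.
have FF : Filter (nbhsF F x) by exact: (@nbhs_filter (tau F) x).
have cv := (@cvg_sup X _ _ (nbhsF F x) x FF).1 (@cvg_id _ _) (exist _ f Ff).
have : nbhs (f x : R[i]^o) [set z | Normc.normc (z - f x) < e].
  exists e%:C; first by rewrite /= ltcR.
  by move=> z; rewrite /= distrC -normc_abs ltcR.
by move=> /(@initial_continuous X R[i]^o f x)/cv.
Qed.

Lemma nbhsF_base (x : X) (A : set X) : nbhsF F x A ->
  exists g e, [/\ real_mem F g, g x = 0, forall y, 0 <= g y, 0 < e &
    forall y, g y < e -> A y].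
Proof.
pose G : set_system X := [set A | exists g e, [/\ real_mem F g, g x = 0,
  forall y, 0 <= g y, 0 < e & forall y, g y < e -> A y]].
have GF : Filter G.
  split.
  - by exists (fun=> 0), 1; split => //; exact: FR_cst.
  - move=> P Q [g [e [Fg gx g0 e0 gP]]] [h [d [Fh hx h0 d0 hQ]]].
    exists (fun y => e^-1 * g y + d^-1 * h y), 1; split => //.
    + by apply: FR_add => //; exact: FR_scale.
    + by rewrite gx hx !mulr0 addr0.
    + by move=> y; rewrite addr_ge0// mulr_ge0// invr_ge0 ltW.
    + move=> y gh1; split; [apply: gP|apply: hQ].
        rewrite -[e]mulr1 -ltr_pdivrMl// (le_lt_trans _ gh1)// lerDl.
        by rewrite mulr_ge0// invr_ge0 ltW.
      rewrite -[d]mulr1 -ltr_pdivrMl// (le_lt_trans _ gh1)// lerDr.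
      by rewrite mulr_ge0// invr_ge0 ltW.
  - move=> P Q PQ [g [e [Fg gx g0 e0 gP]]].
    by exists g, e; split => // y /gP; exact: PQ.
suff : G --> (x : tau F) by apply.
apply/(@cvg_sup X _ _ G x GF) => -[f Ff] B.
rewrite nbhsE => -[U [[V oV <-] Vfx] sUB].
have /nbhs_ballP[d /= d0 dV] : nbhs (f x : R[i]^o) V by exact: open_nbhs_nbhs.
have [e e0 ed] : exists2 e : R, 0 < e & e%:C = d.
  exists (complex.Re d); first by move: d0; rewrite ltcE => /andP[].
  by apply: RRe_real; rewrite gtr0_real.
exists (fun y => Normc.normc (f y - f x) ^+ 2), (e ^+ 2); split.
- exact: FR_sqr_dist.
- by rewrite subrr Normc.normc0 expr0n.
- by move=> y; exact: sqr_ge0.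
- by rewrite exprn_gt0.
- move=> y ye; apply/sUB/dV; rewrite -ball_normE /= distrC -ed.
  rewrite -normc_abs ltcR.
  have n0 : 0 <= Normc.normc (f y - f x).
    by case: (_ - _) => ? ?; exact: sqrtr_ge0.
  by rewrite -(@ltr_pXn2r _ 2)// nnegrE ltW.
Qed.

Lemma nbhsF_family (x : X) : F_family F (nbhsF F x).
Proof.
have NF : ProperFilter (nbhsF F x) by exact: (@nbhs_pfilter (tau F) x).
split=> [|U|U /nbhsF_base[g [e [Fg gx g0 e0 gU]]] UT].
- by exists setT; exact: filterT.
- exact: filter_ex.
have e2 : e / 2 < e by lra.
have [k [Fk k0 k1]] := FR_bump hF Fg e2.
have Nx : nbhsF F x [set y | g y <= e / 2].
  have e20 : 0 < e / 2 by lra.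
  apply: filterS (nbhsF_dist x Fg e20) => y.
  by rewrite /mkset gx subr0 normc_real ger0_norm// => /ltW.
exists [set y | g y <= e / 2], k; split => //.
- apply/seteqP; split=> [_ [y gy <-]|_ ->]; first exact: k0.
  by exists x; rewrite ?k0//= gx; lra.
- have [y Uy] : ~` U !=set0.
    by apply/set0P/negP => /eqP/(congr1 setC); rewrite setCK setC0 => /UT.
  have off z : (~` U) z -> k z = 1.
    by move=> Uz; apply: k1; rewrite leNgt; apply/negP => /gU.
  apply/seteqP; split=> [_ [z Uz <-]|_ ->]; first exact: off.
  by exists y => //; exact: off.
Qed.

Lemma nbhsF_ultrafilter (x : X) : F_ultrafilter F (nbhsF F x).
Proof.
have NF : ProperFilter (nbhsF F x) by exact: (@nbhs_pfilter (tau F) x).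
split=> [|q [qF [_ _ qfam]] [Nq]]; first by split=> //; exact: nbhsF_family.
apply=> A qA; have [->|/eqP AT] := eqVneq A setT; first exact: filterT.
have [B [f [qB Ff fB fA]]] := qfam A qA AT.
have f0 y : B y -> f y = 0.
  by move=> By; have : (f @` B) (f y) by [exists y]; rewrite fB.
have fx : f x = 0.
  apply/eqP/negPn/negP => fx0.
  have d0 : 0 < Normc.normc (f x).
    by rewrite -ltcR normc_abs normr_gt0.
  have /Nq qD := nbhsF_dist x Ff d0.
  have [y [By /=]] := @filter_ex _ _ qF _ (filterI qB qD).
  by rewrite f0// sub0r -ltcR !normc_abs normrN ltxx.
apply: filterS (nbhsF_dist x Ff ltr01) => y /=.
rewrite fx subr0 => fy; apply/not_notP => Ay.
have : (f @` (~` A)) (f y) by exists y.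
by rewrite fA => f1; move: fy; rewrite f1 -ltcR normc_abs normr1 ltxx.
Qed.

Definition evaluation (x : X) : delta F :=
  exist _ (nbhsF F x) (nbhsF_ultrafilter x).

Definition bar_filter (phi : set_system X) : set (delta F) :=
  \bigcap_(A in phi) closure (evaluation @` A).

End NbhsF.

(* Main.v *)
Require Import Defs.
From HB Require Import structures.
From mathcomp Require Import all_boot all_order all_algebra.
From mathcomp Require Import complex.
From mathcomp Require Import all_classical all_reals all_analysis.

(** An element [p] of [delta F] lies in [closure (evaluation hF @` A)] exactly
when every member [C] of [p] is a neighbourhood of some point of [A]; so both
sides of the equality say how [p] meets the members of [phi].

If [phi `<=` p], [A] is in [phi] and [C] in [p], pick [B] in [p] and [f] in [F]
with [f] zero on [B] and one off [C]. Since [A] and [B] are both in [p], they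
have a common point [x]; there [f x = 0], so by continuity of [f] the set [C],
which contains [{|f| < 1}], is a neighbourhood of [x].

Conversely, if [p] is in all the closures, then every member of [p] meets every
member of [phi]. Two [F]-filters that meet generate an [F]-filter
([F_filter_join]): if [f] separates [C'] from the complement of [C] and [g]
separates [B'] from the complement of [B], then [1 - (1 - f) (1 - g)] separates
[C' `&` B'] from the complement of [C `&` B]. The filter generated by [p] and
[phi] contains [p], hence equals [p] by maximality, and so [phi `<=` p]. *)

Import Order.TTheory GRing.Theory Num.Theory ComplexField.

Local Open Scope classical_set_scope.
Local Open Scope ring_scope.
Local Open Scope complex_scope.

Set Implicit Arguments.
Unset Strict Implicit.

(** The pointwise form of [f @` B = [set 0]] and [f @` (~` A) = [set 1]]. The
latter fails for [A = setT], whereas the pointwise condition off [A] is then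
vacuous; so the full set needs no separate treatment. *)
Definition separates {R : realType} {X : Type} (f : X -> R[i])
    (B A : set X) : Prop :=
  (forall x, B x -> f x = 0) /\ (forall x, ~ A x -> f x = 1).

Section Separation.
Variables (R : realType) (X : Type) (F : set (X -> R[i])).
Hypothesis hF : unital_cstar_subalgebra F.
Implicit Types (p q : set_system X) (A B C D : set X).

Lemma F_filter_separates p A : F_filter F p -> p A ->
  exists B f, [/\ p B, F f & separates f B A].
Proof.
move=> [pF [_ _ pfam]] pA; have [->|/eqP AT] := eqVneq A setT.
  exists setT, (fun=> 0); split; [exact: filterT | exact: (ucs_cst hF) |].
  by split=> // x /(_ I).
have [B [f [pB Ff f0 f1]]] := pfam A pA AT.
exists B, f; split=> //; split=> x Hx.
- by have : (f @` B) (f x) by [exists x]; rewrite f0.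
- by have : (f @` (~` A)) (f x) by [exists x]; rewrite f1.
Qed.

Lemma separates_F_filter p : ProperFilter p ->
  (forall A, p A -> exists B f, [/\ p B, F f & separates f B A]) ->
  F_filter F p.
Proof.
move=> pF psep; split=> //; split=> [|A|A pA AT].
- by exists setT; exact: filterT.
- exact: filter_ex.
have [B [f [pB Ff [f0 f1]]]] := psep A pA.
exists B, f; split=> //; apply/seteqP; split=> [_ [x Hx <-]|_ ->].
- exact: f0.
- by have [x Bx] := filter_ex pB; exists x => //; exact: f0.
- exact: f1.
- have [x Ax] : ~` A !=set0.
    by apply/set0P/negP => /eqP/(congr1 setC); rewrite setCK setC0 => /AT.
  by exists x => //; exact: f1.
Qed.

(** Take [1 - (1 - f) (1 - g)]: the product is one where both factors are one and
zero where either is zero. *)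
Lemma separatesI A B C D f g : F f -> F g ->
  separates f B A -> separates g D C ->
  exists2 h, F h & separates h (B `&` D) (A `&` C).
Proof.
move=> Ff Fg [f0 f1] [g0 g1].
have FB k : F k -> F (fun x => 1 + -1 * k x).
  by move=> Fk; apply: (ucs_add hF); [exact: (ucs_cst hF)|exact: (ucs_scale hF)].
exists (fun x => 1 + -1 * ((1 + -1 * f x) * (1 + -1 * g x))).
  by apply/FB/(ucs_mul hF); exact: FB.
split=> x.
  by move=> [Bx Dx]; rewrite f0// g0// mulr0 addr0 !mulr1 subrr.
move=> /not_andP[Ax|Cx]; first by rewrite f1// mulr1 subrr mul0r mulr0 addr0.
by rewrite g1// mulr1 subrr !mulr0 addr0.
Qed.

(** When [p] and [q] are filters that meet, this is the filter that they
generate. *)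
Definition filter_join p q : set_system X :=
  [set A | exists B C, [/\ p B, q C & B `&` C `<=` A]].

Lemma filter_join_subl p q : Filter q -> p `<=` filter_join p q.
Proof.
by move=> qF A pA; exists A, setT; split=> [||x []] //; exact: filterT.
Qed.

Lemma filter_join_subr p q : Filter p -> q `<=` filter_join p q.
Proof.
by move=> pF A qA; exists setT, A; split=> [||x []] //; exact: filterT.
Qed.

Lemma filter_join_proper p q : Filter p -> Filter q -> p `#` q ->
  ProperFilter (filter_join p q).
Proof.
move=> pF qF pq; split.
  by move=> [B [C [pB qC BC0]]]; have [x /BC0] := pq _ _ pB qC.
split.
- by apply: filter_join_subl; exact: filterT.
- move=> A A' [B [C [pB qC BCA]]] [B' [C' [pB' qC' BCA']]].
  exists (B `&` B'), (C `&` C'); split; [exact: filterI | exact: filterI |].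
  by move=> x [[Bx B'x] [Cx C'x]]; split; [exact: BCA | exact: BCA'].
- move=> A A' AA' [B [C [pB qC BCA]]].
  by exists B, C; split=> //; exact: subset_trans AA'.
Qed.

Lemma F_filter_join p q : F_filter F p -> F_filter F q -> p `#` q ->
  F_filter F (filter_join p q).
Proof.
move=> pF qF pq; have [[? _] [? _]] := (pF, qF).
apply: separates_F_filter => [|A [B [C [pB qC BCA]]]].
  exact: filter_join_proper.
have [B' [f [pB' Ff fB]]] := F_filter_separates pF pB.
have [C' [g [qC' Fg gC]]] := F_filter_separates qF qC.
have [h Fh [h0 h1]] := separatesI Ff Fg fB gC.
exists (B' `&` C'), h; split=> //; first by exists B', C'; split.
by split=> // x Ax; apply: h1 => /BCA.
Qed.

(** The join of [p] and [q] contains [p], so it cannot be larger. *)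
Lemma F_ultrafilter_meets_sub p q : F_ultrafilter F p -> F_filter F q ->
  p `#` q -> q `<=` p.
Proof.
move=> [pF pmax] qF pq; have [[? _] [? _]] := (pF, qF).
have /pmax jp := F_filter_join pF qF pq.
apply: subset_trans (@filter_join_subr p q _) _; apply/not_notP => njp.
by apply: jp; split=> //; exact: filter_join_subl.
Qed.

End Separation.

(** [f] is continuous for [tau F] and vanishes at [x], so [|f| < 1] near [x], and
a point where [|f| < 1] cannot lie outside [A]. *)
Lemma nbhsF_separates (R : realType) (X : pointedType) (F : set (X -> R[i]))
    (f : X -> R[i]) (B A : set X) (x : X) :
  F f -> separates f B A -> B x -> nbhsF F x A.
Proof.
move=> Ff [f0 f1] Bx; have ? : Filter (nbhsF F x).
  exact: (@nbhs_filter (tau F) x).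
apply: filterS (nbhsF_dist x Ff ltr01) => y /=.
rewrite (f0 x)// subr0 => fy1; apply/not_notP => /f1 fy.
by move: fy1; rewrite fy -ltcR normc_abs normr1 ltxx.
Qed.

(** The sets [hat C] form a base of [delta F], and [evaluation hF x] is in [hat C]
exactly when [C] is a neighbourhood of [x]. *)
Lemma closure_evaluationP (R : realType) (X : pointedType)
    (F : set (X -> R[i])) (hF : unital_cstar_subalgebra F) (A : set X)
    (p : delta F) :
  closure (evaluation hF @` A) p <->
  forall C, sval p C -> exists2 x, A x & nbhsF F x C.
Proof.
split=> [clp C pC|Ap U].
  (* [hat C] is open, as the union of a one-element subfamily of the base. *)
  have /clp[_ [[x Ax <-] xC]] : nbhs p (hat C).
    apply: open_nbhs_nbhs; split=> //.
    by exists [set C] => //; rewrite bigcup_set1.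
  by exists x.
rewrite nbhsE => -[V [[D _ DV] Vp] VU].
move: (Vp); rewrite -DV => -[C DC /Ap[x Ax xC]].
exists (evaluation hF x); split; first by exists x.
by apply: VU; rewrite -DV; exists C.
Qed.

Theorem theorem20 (R : realType) (X : pointedType) (F : set (X -> R[i]))
    (hF : unital_cstar_subalgebra F)
    (phi : set_system X) (hphi : F_filter F phi) :
  hat_filter phi = bar_filter hF phi :> set (delta F).
Proof.
apply/seteqP; split=> p.
  move=> phip A phiA; apply/closure_evaluationP => C pC.
  have pF := (svalP p).1; have [? _] := pF.
  have [B [f [pB Ff fBC]]] := F_filter_separates hF pF pC.
  have [x [Ax Bx]] := filter_ex (filterI (phip A phiA) pB).
  by exists x => //; exact: nbhsF_separates Ff fBC Bx.
move=> clp; apply: (F_ultrafilter_meets_sub hF) (svalP p) hphi _.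
move=> C A pC phiA.
have /closure_evaluationP/(_ C pC)[x Ax xC] := clp A phiA.
by exists x; split=> //; exact: (@nbhs_singleton (tau F)) xC.
Qed.
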